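(* Let $D$ be a finite set with $m+1$ elements ($m\ge1$), $n\ge1$, $\epsilon\ge0$, $0\le\delta\le1$, and put $p=\frac{1-\delta}{e^{\epsilon}+m}$. Let $\{X_d\mid d\in D\}$ be the parent mechanism with $\mathbb{P}(X_d=d)=1-pm$ and $\mathbb{P}(X_d=d')=p$ for all $d'\ne d$, and $\{X_{\mathbf{d}}\}$ its product sanitisation mechanism. Then for every parent mechanism $\{Y_d\mid d\in D\}$ that is $(\epsilon,\delta)$-differentially private (i.e. $\mathbb{P}(Y_d\in A)\le e^{\epsilon}\mathbb{P}(Y_{d'}\in A)+\delta$ for all $d,d'\in D$, $A\subseteq D$), with product sanitisation mechanism $\{Y_{\mathbf{d}}\}$, $$\max_{\mathbf{d}\in D^n}\mathbb{E}[h(X_{\mathbf{d}},\mathbf{d})]\le\max_{\mathbf{d}\in D^n}\mathbb{E}[h(Y_{\mathbf{d}},\mathbf{d})].$$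
   Context: A parent mechanism is a family of $D$-valued random variables $\{Y_d\mid d\in D\}$ (equivalently a row-stochastic $(m+1)\times(m+1)$ matrix). The product sanitisation mechanism with parent $\{Y_d\}$ is $Y_{\mathbf{d}}=(Y^1_{\mathbf{d}},\dots,Y^n_{\mathbf{d}})$, $\mathbf{d}\in D^n$, with independent coordinates and $Y^i_{\mathbf{d}}$ distributed as $Y_{d_i}$. $h$ is the Hamming distance on $D^n$. *)

(* Defs.v *)
From mathcomp Require Import all_boot all_order all_algebra.
From mathcomp Require Import reals sequences exp.
Set Implicit Arguments.
Unset Strict Implicit.
Unset Printing Implicit Defensive.
Import Order.TTheory GRing.Theory Num.Theory.
Local Open Scope ring_scope.

(* The law of a random variable with values in a finite type. *)
Record law (R : realType) (T : finType) := Law {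
  pmf :> T -> R;
  pmf_ge0 : forall t, 0 <= pmf t;
  pmf_sum1 : \sum_t pmf t = 1
}.

Definition Pr (R : realType) (T : finType) (P : law R T) (A : {set T}) : R :=
  \sum_(t in A) P t.

Definition expect (R : realType) (T : finType) (P : law R T) (f : T -> R) : R :=
  \sum_t P t * f t.

(* The family {Y_d | d in D}, given by the laws of the Y_d: the row-stochastic
   matrix with entries Y d d' = P(Y_d = d'). *)
Definition parent_mechanism (R : realType) (D : finType) : Type := D -> law R D.

Definition diff_private (R : realType) (D : finType) (eps delta : R)
    (Y : parent_mechanism R D) : Prop :=
  forall (d d' : D) (A : {set D}),
    Pr (Y d) A <= expR eps * Pr (Y d') A + delta.

Section Product.
Variables (R : realType) (D : finType) (n : nat) (Y : parent_mechanism R D).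
Variable d : {ffun 'I_n -> D}.

Definition product_pmf (x : {ffun 'I_n -> D}) : R := \prod_i Y (d i) (x i).

Fact product_pmf_ge0 x : 0 <= product_pmf x.
Proof. by apply: prodr_ge0 => i _; apply: pmf_ge0. Qed.

Fact product_pmf_sum1 : \sum_x product_pmf x = 1.
Proof.
rewrite /product_pmf -(bigA_distr_bigA (fun i a => Y (d i) a)).
by apply: big1 => i _; apply: pmf_sum1.
Qed.

(* The joint law on D^n of independent coordinates, the i-th one distributed
   as Y_(d_i). *)
Definition product_mechanism : law R {ffun 'I_n -> D} :=
  Law product_pmf_ge0 product_pmf_sum1.
End Product.

Definition hamming (D : finType) (n : nat) (x y : {ffun 'I_n -> D}) : nat :=
  #|[set i | x i != y i]|.

(* The maximum over D^n of the expected Hamming error; the base value 0 of the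
   iterated maximum is harmless, as the errors are nonnegative. *)
Definition max_error (R : realType) (D : finType) (n : nat)
    (Y : parent_mechanism R D) : R :=
  \big[Num.max/0]_(d : {ffun 'I_n -> D})
     expect (product_mechanism Y d) (fun x => (hamming x d)%:R).

(* With these values the rows are indeed probability laws, so requiring them of
   a parent mechanism is not vacuous. *)
Lemma randomized_response_exists (R : realType) (D : finType) (m : nat)
    (eps delta : R) (p := (1 - delta) / (expR eps + m%:R)) :
  #|D| = m.+1 -> 0 <= eps -> 0 <= delta <= 1 ->
  exists X : parent_mechanism R D,
    (forall d, X d d = 1 - p * m%:R) /\
    (forall d d', d' != d -> X d d' = p).
Proof.
move=> cD eps0 /andP[delta0 delta1].
have e0 : 0 < expR eps + m%:R :> R by rewrite ltr_wpDr ?expR_gt0.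
have p0 : 0 <= p by rewrite divr_ge0 ?subr_ge0 // ltW.
have pm1 : 0 <= 1 - p * m%:R.
  rewrite subr_ge0 /p mulrAC ler_pdivrMr // mul1r.
  apply: (@le_trans _ _ m%:R); last by rewrite lerDr expR_ge0.
  by rewrite ler_piMl // lerBlDr lerDl.
pose f d d' : R := if d' == d :> D then 1 - p * m%:R else p.
have f0 d d' : 0 <= f d d' by rewrite /f; case: ifP.
have f1 d : \sum_d' f d d' = 1.
  rewrite (bigD1 d) //= {1}/f eqxx (eq_bigr (fun=> p)); last first.
    by move=> i /negPf id; rewrite /f id.
  by rewrite sumr_const cardC1 cD mulr_natr subrK.
exists (fun d => Law (f0 d) (f1 d)); split=> [d|d d' /negPf dd'] /=.
  by rewrite /f eqxx.
by rewrite /f dd'.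
Qed.

(* Main.v *)
(** The expected Hamming error of a product mechanism at [d] is the sum of the
    one-coordinate errors [1 - Y (d i) (d i)], so it is enough to bound one of
    these from below. If [d0] minimises [a := Y d0 d0], privacy on the singletons
    [d != d0] gives [e^eps * Y d0 d >= Y d d - delta >= a - delta]; summing over
    [d] yields [e^eps * (1 - a) >= m * (a - delta)], that is [1 - a >= p * m].
    The constant vector [d0] then has error at least [n * p * m], which is the
    error of randomised response at every point. *)
Require Import Defs.
From mathcomp Require Import all_boot all_order all_algebra.
From mathcomp Require Import reals sequences exp.
From mathcomp Require Import lra.
Set Implicit Arguments.
Unset Strict Implicit.
Unset Printing Implicit Defensive.
Import Order.TTheory GRing.Theory Num.Theory.
Local Open Scope ring_scope.

(** Absorbing [f] into the [i]-th factor keeps the summand a product over coordinates, so the sum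
    over vectors factors into one sum per coordinate; each sum with [j != i] is a total mass, hence
    1. *)
Lemma product_pmf_marginal (R : realType) (D : finType) (n : nat)
    (Y : parent_mechanism R D) (d : {ffun 'I_n -> D}) (i : 'I_n) (f : D -> R) :
  expect (product_mechanism Y d) (fun x => f (x i)) = expect (Y (d i)) f.
Proof.
pose F j a := Y (d j) a * (if j == i then f a else 1).
rewrite /expect (eq_bigr (fun x : {ffun 'I_n -> D} => \prod_j F j (x j))).
  rewrite -(bigA_distr_bigA F) (bigD1 i) //= [X in _ * X]big1 ?mulr1.
    by apply: eq_bigr => a _; rewrite /F eqxx.
  move=> j /negPf ji; rewrite -(pmf_sum1 (Y (d j))).
  by apply: eq_bigr => a _; rewrite /F ji mulr1.
move=> x _; rewrite /F big_split /= /product_pmf; congr (_ * _).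
by rewrite -big_mkcond big_pred1_eq.
Qed.

Lemma expect_ge0 (R : realType) (T : finType) (P : law R T) (f : T -> R) :
  (forall t, 0 <= f t) -> 0 <= expect P f.
Proof. by move=> f0; apply: sumr_ge0 => t _; rewrite mulr_ge0 ?pmf_ge0. Qed.

Lemma pmf_sum_neq (R : realType) (T : finType) (P : law R T) (t0 : T) :
  \sum_(t | t != t0) P t = 1 - P t0.
Proof. by apply/eqP; rewrite eq_sym subr_eq addrC -(pmf_sum1 P) (bigD1 t0). Qed.

Lemma expect_neq (R : realType) (T : finType) (P : law R T) (t0 : T) :
  expect P (fun t => (t != t0)%:R) = 1 - P t0.
Proof.
rewrite -pmf_sum_neq /expect (bigD1 t0) //= eqxx mulr0 add0r.
by apply: eq_bigr => t ->; rewrite mulr1.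
Qed.

Lemma hammingE (D : finType) (n : nat) (x y : {ffun 'I_n -> D}) :
  hamming x y = (\sum_i (x i != y i))%N.
Proof. by rewrite /hamming cardsE -sum1_card big_mkcond. Qed.

(** Linearity of expectation: the distance is a sum of indicators, each depending on a single
    coordinate and hence only on its marginal. *)
Lemma expect_hamming (R : realType) (D : finType) (n : nat)
    (Y : parent_mechanism R D) (d : {ffun 'I_n -> D}) :
  expect (product_mechanism Y d) (fun x => (hamming x d)%:R) =
  \sum_i (1 - Y (d i) (d i)).
Proof.
transitivity (\sum_i expect (product_mechanism Y d) (fun x => (x i != d i)%:R)).
  rewrite /expect exchange_big /=; apply: eq_bigr => x _.
  by rewrite hammingE natr_sum mulr_sumr.
apply: eq_bigr => i _.
by rewrite (product_pmf_marginal Y d i (fun a => (a != d i)%:R)) expect_neq.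
Qed.

Lemma diff_private_pmf (R : realType) (D : finType) (eps delta : R)
    (Y : parent_mechanism R D) (d d' a : D) :
  diff_private eps delta Y -> Y d a <= expR eps * Y d' a + delta.
Proof. by move=> /(_ d d' [set a]); rewrite /Pr !big_set1. Qed.

Lemma diff_private_error_ge (R : realType) (D : finType) (m : nat)
    (eps delta : R) (Y : parent_mechanism R D) :
  #|D| = m.+1 -> diff_private eps delta Y ->
  exists d, (1 - delta) / (expR eps + m%:R) * m%:R <= 1 - Y d d.
Proof.
move=> cD privY.
have /card_gt0P[d1 _] : (0 < #|D|)%N by rewrite cD.
have [d0 _ mind0] := @Order.TotalTheory.arg_minP _ _ _ d1 xpredT
  (fun d => Y d d) isT.
exists d0.
have key : (Y d0 d0 - delta) * m%:R <= expR eps * (1 - Y d0 d0).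
  rewrite -pmf_sum_neq mulr_sumr mulr_natr.
  have -> : m = #|[pred d | d != d0]| by rewrite cardC1 cD.
  rewrite -sumr_const; apply: ler_sum => d _.
  by rewrite lerBlDr (le_trans (mind0 d isT)) // diff_private_pmf.
have e0 : 0 < expR eps + m%:R :> R by rewrite ltr_wpDr ?expR_gt0.
(* With the denominator cleared, the goal is [key] with [m%:R * (1 - Y d0 d0)] added to both
   sides. *)
rewrite mulrAC ler_pdivrMr //; move: key; lra.
Qed.

Theorem theorem10 (R : realType) (D : finType) (m n : nat) (eps delta p : R)
    (X : parent_mechanism R D)
    (hm : (1 <= m)%N) (hD : #|D| = m.+1) (hn : (1 <= n)%N)
    (heps : 0 <= eps) (hdelta : 0 <= delta <= 1)
    (hp : p = (1 - delta) / (expR eps + m%:R))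
    (hXd : forall d : D, X d d = 1 - p * m%:R)
    (hXd' : forall d d' : D, d' != d -> X d d' = p) :
  forall Y : parent_mechanism R D, diff_private eps delta Y ->
    max_error n X <= max_error n Y.
Proof.
move=> Y privY.
have [d0 hd0] := diff_private_error_ge hD privY.
(* Needed for the base value 0 of the maximum in [max_error n X]. *)
have err0 : 0 <= 1 - Y d0 d0 by rewrite -expect_neq expect_ge0.
(* The middle term is the error of [Y] at the constant vector [d0]; it dominates the error of [X] at
   every [d], coordinate by coordinate. *)
apply: (@le_trans _ _ (\sum_(i < n) (1 - Y d0 d0))).
  apply: bigmax_le => [|d _]; first by rewrite sumr_ge0.
  rewrite expect_hamming; apply: ler_sum => i _.
  by rewrite hXd opprB addrCA subrr addr0 hp.
have -> : \sum_(i < n) (1 - Y d0 d0) =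
    expect (product_mechanism Y [ffun=> d0])
           (fun x : {ffun 'I_n -> D} => (hamming x [ffun=> d0])%:R).
  by rewrite expect_hamming; apply: eq_bigr => i _; rewrite ffunE.
exact: le_bigmax.
Qed.
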